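(* Let $f=\frac1N\sum_{j=1}^N f_j$ on the Riemannian manifold $\mathcal M$ satisfy the retraction smoothness assumption with constant $L_r>0$ and the bounded variance estimator assumption with constant $\sigma>0$ (both stated in the context). Let $0\le\eta_{\min}\le\eta_{\max}<\frac{2}{L_r}$ with $\eta_{\max}>0$, let $p>0$, $K\in\mathbb N$ ($K\ge1$), $b_0>0$, $\gamma>1$, $c>1$, $a>0$. For a total number of iterations $T\ge1$, let the batch size be one of the following, where $m=\lfloor t/K\rfloor$: (i) exponential growth: $b_t=b_0\gamma^{m}$; (ii) polynomial growth: $b_t=(am+b_0)^c$; and let the learning rate be one of the following, for $t\in\{0,\dots,T-1\}$: (1) constant: $\eta_t=\eta_{\max}$; (2) diminishing: $\eta_t=\frac{\eta_{\max}}{\sqrt{t+1}}$; (3) cosine annealing: $\eta_t=\eta_{\min}+\frac{\eta_{\max}-\eta_{\min}}{2}\left(1+\cos\frac{t}{T}\pi\right)$; (4) polynomial decay: $\eta_t=\eta_{\min}+(\eta_{\max}-\eta_{\min})\left(1-\frac tT\right)^p$. Let $(x_t)_t$ be generated by RSGD with these batch sizes and learning rates. Then, for both batch size schedules (i) and (ii), there are constants $Q_1,Q_2,\tilde Q_1,\tilde Q_2$ that do not depend on $T$ such that: for the diminishing learning rate (2), $$\min_{t\in\{0,\dots,T-1\}}\mathbb E\left[\|\mathrm{grad}f(x_t)\|_{x_t}^2\right]\le\frac{Q_1+Q_2\sigma^2b_0^{-1}}{\sqrt T}=O\left(\frac{1}{\sqrt T}\right);$$ for each of the learning rates (1), (3),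 (4), $$\min_{t\in\{0,\dots,T-1\}}\mathbb E\left[\|\mathrm{grad}f(x_t)\|_{x_t}^2\right]\le\frac{\tilde Q_1+\tilde Q_2\sigma^2b_0^{-1}}{T}=O\left(\frac1T\right).$$
   Context: $\mathcal M$ is a Riemannian manifold with inner product $\langle\cdot,\cdot\rangle_x$ and norm $\|\cdot\|_x$ on the tangent space $T_x\mathcal M$; $\mathrm{grad}$ denotes the Riemannian gradient. A retraction is a map $R\colon T\mathcal M\ni(x,v)\mapsto R_x(v)\in\mathcal M$ with $R_x(0_x)=x$ and $DR_x(0_x)=\mathrm{id}_{T_x\mathcal M}$ (identifying $T_{0_x}T_x\mathcal M\simeq T_x\mathcal M$) for all $x\in\mathcal M$; a retraction $R$ on $\mathcal M$ is fixed. Each $f_j\colon\mathcal M\to\mathbb R$ ($j=1,\dots,N$) is smooth and bounded below, and $f=\frac1N\sum_{j=1}^Nf_j$. Retraction smoothness: there is $L_r>0$ such that $f(R_x(v))\le f(x)+\langle\mathrm{grad}f(x),v\rangle_x+\frac{L_r}{2}\|v\|_x^2$ for all $x\in\mathcal M$, $v\in T_x\mathcal M$. Bounded variance estimator: $\Pi$ is a probability distribution on $\{1,\dots,N\}$ with (I) $\mathbb E_{\xi\sim\Pi}[\mathrm{grad}f_\xi(x)]=\mathrm{grad}f(x)$ for all $x\in\mathcal M$, and (II) there is $\sigma>0$ with $\mathbb E_{\xi\sim\Pi}[\|\mathrm{grad}f_\xi(x)-\mathrm{grad}f(x)\|_x^2]\le\sigma^2$ for all $x\in\mathcal M$. RSGD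 (Riemannian stochastic gradient descent) with learning rates $\eta_t$ and batch sizes $b_t$ (the schedule parameters are such that all $b_t$ are positive integers): from a given deterministic $x_0\in\mathcal M$, $x_{t+1}=R_{x_t}(-\eta_t\,\mathrm{grad}f_{B_t}(x_t))$, where $\mathrm{grad}f_{B_t}(x)=\frac1{b_t}\sum_{i=1}^{b_t}\mathrm{grad}f_{\xi_{i,t}}(x)$ and $(\xi_{i,t})_{i,t}$ are i.i.d. with law $\Pi$. $\mathbb E$ is the total expectation over all samples. The $O$-notation refers to $T\to\infty$ with the remaining data (including $K$) fixed. *)

(* Defs.v *)
From HB Require Import structures.
From mathcomp Require Import all_boot all_order all_algebra.
From mathcomp Require Import all_classical all_reals all_analysis.

Set Implicit Arguments.
Unset Strict Implicit.
Unset Printing Implicit Defensive.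

Import Order.TTheory GRing.Theory Num.Theory.
Import numFieldNormedType.Exports.

Local Open Scope classical_set_scope.
Local Open Scope ring_scope.

(* Only used on open sets U, so that the values of f outside U are irrelevant.
   Quantifying over the direction v is enough because V is finite-dimensional
   in all uses below. *)
Fixpoint Ck_on (R : realType) (V W : normedModType R) (k : nat) (U : set V)
    (f : V -> W) : Prop :=
  if k is k'.+1 then
    (forall x, U x -> differentiable f x) /\
    (forall v : V, Ck_on k' U (fun x => 'd f x v))
  else forall x, U x -> {for x, continuous f}.

Definition smooth_on (R : realType) (V W : normedModType R) (U : set V)
    (f : V -> W) : Prop := forall k, Ck_on k U f.

(* A homeomorphism between open subsets of M and of R^n, given by two total
   functions whose values outside of these subsets are irrelevant. *)
Record chart (R : realType) (n : nat) (M : topologicalType) := Chart {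
  cdom : set M;
  cmap : M -> 'rV[R]_n;
  cinv : 'rV[R]_n -> M;
  cdom_open : open cdom;
  cimg_open : open (cmap @` cdom);
  cmapK : forall x, cdom x -> cinv (cmap x) = x;
  cmap_continuous : forall x, cdom x -> {for x, continuous cmap};
  cinv_continuous : forall y, (cmap @` cdom) y -> {for y, continuous cinv} }.

Record smooth_manifold (R : realType) (n : nat) := SmoothManifold {
  msort :> topologicalType;
  manifold_hausdorff : hausdorff_space msort;
  manifold_second_countable : @second_countable msort;
  atlas : set (chart R n msort);
  atlas_compatible : forall phi psi, atlas phi -> atlas psi ->
    smooth_on (cmap phi @` (cdom phi `&` cdom psi)) (cmap psi \o cinv phi);
  chart_at : msort -> chart R n msort;
  chart_at_atlas : forall x, atlas (chart_at x);
  chart_at_dom : forall x, cdom (chart_at x) x }.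

Definition smooth_fun (R : realType) (n : nat) (M : smooth_manifold R n)
    (f : M -> R) : Prop :=
  forall phi : chart R n M, atlas phi ->
    smooth_on (cmap phi @` cdom phi) (f \o cinv phi : 'rV[R]_n -> R^o).

(* The tangent space T_x M is represented by R^n: a vector stands for the
   tangent vector with these coordinates in the chart [chart_at x]. *)
Definition differential (R : realType) (n : nat) (M : smooth_manifold R n)
    (f : M -> R) (x : M) (v : 'rV[R]_n) : R :=
  'd (f \o cinv (chart_at x) : 'rV[R]_n -> R^o) (cmap (chart_at x) x) v.

(* The tangent vector at [cinv phi y] with coordinates u in the chart phi. *)
Definition from_chart (R : realType) (n : nat) (M : smooth_manifold R n)
    (phi : chart R n M) (y u : 'rV[R]_n) : 'rV[R]_n :=
  'd (cmap (chart_at (cinv phi y)) \o cinv phi) y u.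

(* As [chart_at x] need not depend continuously on x, smoothness of the metric
   is that of its coefficients in the charts of the atlas. *)
Record riemannian_manifold (R : realType) (n : nat) := RiemannianManifold {
  rsort :> smooth_manifold R n;
  inner : rsort -> 'rV[R]_n -> 'rV[R]_n -> R;
  inner_linear : forall x u v w (k : R),
    inner x (k *: u + v) w = k * inner x u w + inner x v w;
  inner_sym : forall x u v, inner x u v = inner x v u;
  inner_pos : forall x u, u != 0 -> 0 < inner x u u;
  inner_smooth : forall phi : chart R n rsort, atlas phi ->
    forall u v : 'rV[R]_n,
    smooth_on (cmap phi @` cdom phi)
      (fun y => inner (cinv phi y) (from_chart phi y u) (from_chart phi y v)
         : R^o) }.

Definition tnorm (R : realType) (n : nat) (M : riemannian_manifold R n)
    (x : M) (v : 'rV[R]_n) : R := Num.sqrt (inner x v v).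

Definition grad (R : realType) (n : nat) (M : riemannian_manifold R n)
    (f : M -> R) (x : M) : 'rV[R]_n :=
  get [set w | forall v, inner x w v = differential f x v].

(* Differentiability of R_x at 0 as a map into M is continuity at 0 together
   with differentiability in the chart at x = R_x(0); in the coordinates of
   that chart the condition D R_x(0) = id is on the nose. *)
Definition retraction (R : realType) (n : nat) (M : smooth_manifold R n)
    (retr : M -> 'rV[R]_n -> M) : Prop :=
  forall x : M,
    [/\ retr x 0 = x,
        {for 0, continuous (retr x)},
        differentiable (cmap (chart_at x) \o retr x) (0 : 'rV[R]_n) &
        forall v, 'd (cmap (chart_at x) \o retr x) (0 : 'rV[R]_n) v = v].

Definition retraction_smooth (R : realType) (n : nat)
    (M : riemannian_manifold R n) (retr : M -> 'rV[R]_n -> M) (f : M -> R)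
    (L : R) : Prop :=
  forall (x : M) (v : 'rV[R]_n),
    f (retr x v) <= f x + inner x (grad f x) v + L / 2 * tnorm x v ^+ 2.

Definition bounded_below (R : realType) (T : Type) (f : T -> R) : Prop :=
  exists m : R, forall x, m <= f x.

Definition average (R : realType) (T : Type) (N : nat) (fs : 'I_N -> T -> R)
    (x : T) : R := N%:R^-1 * \sum_(j < N) fs j x.

Definition is_pmf (R : realType) (N : nat) (law : 'I_N -> R) : Prop :=
  (forall j, 0 <= law j) /\ \sum_(j < N) law j = 1.

Definition bounded_variance_estimator (R : realType) (n : nat)
    (M : riemannian_manifold R n) (N : nat) (fs : 'I_N -> M -> R)
    (law : 'I_N -> R) (sigma : R) : Prop :=
  (forall x : M,
     \sum_(j < N) law j *: grad (fs j) x = grad (average fs) x) /\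
  (forall x : M,
     \sum_(j < N) law j * tnorm x (grad (fs j) x - grad (average fs) x) ^+ 2
       <= sigma ^+ 2).

(* Independence: product rule over every finite subfamily, a finite set of
   indices (i, t) being listed by a duplicate-free sequence. *)
Definition iid_with_law (R : realType) (d : measure_display)
    (Omega : measurableType d) (P : probability Omega R) (N : nat)
    (law : 'I_N -> R) (xi : nat -> nat -> Omega -> 'I_N) : Prop :=
  [/\ forall i t j, measurable (xi i t @^-1` [set j]),
      forall i t j, P (xi i t @^-1` [set j]) = (law j)%:E &
      forall (s : seq (nat * nat)) (A : nat * nat -> set 'I_N), uniq s ->
        P (\bigcap_(k in [set` s]) (xi k.1 k.2 @^-1` A k)) =
        (\prod_(k <- s) P (xi k.1 k.2 @^-1` A k))%E].

Definition batch_grad (R : realType) (n : nat) (M : riemannian_manifold R n)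
    (N : nat) (fs : 'I_N -> M -> R) (b : nat) (xi : nat -> 'I_N) (x : M) :
    'rV[R]_n :=
  b%:R^-1 *: \sum_(i < b) grad (fs (xi i)) x.

Fixpoint rsgd (R : realType) (n : nat) (M : riemannian_manifold R n)
    (retr : M -> 'rV[R]_n -> M) (N : nat) (fs : 'I_N -> M -> R)
    (eta : nat -> R) (b : nat -> nat) (xi : nat -> nat -> 'I_N) (x0 : M)
    (t : nat) : M :=
  if t is s.+1 then
    let x := rsgd retr fs eta b xi x0 s in
    retr x (- (eta s *: batch_grad fs (b s) (fun i => xi i s) x))
  else x0.

Definition exponential_batch (R : realType) (K : nat) (b0 gamma : R)
    (b : nat -> nat) : Prop :=
  forall t, (b t)%:R = b0 * gamma ^+ (t %/ K)%N.

Definition polynomial_batch (R : realType) (K : nat) (b0 a c : R)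
    (b : nat -> nat) : Prop :=
  forall t, (b t)%:R = (a * (t %/ K)%:R + b0) `^ c.

Definition lr_constant (R : realType) (etamax : R) (T t : nat) : R := etamax.

Definition lr_diminishing (R : realType) (etamax : R) (T t : nat) : R :=
  etamax / Num.sqrt (t.+1)%:R.

Definition lr_cosine (R : realType) (etamin etamax : R) (T t : nat) : R :=
  etamin + (etamax - etamin) / 2 * (1 + cos (t%:R / T%:R * pi)).

Definition lr_polynomial (R : realType) (etamin etamax p : R) (T t : nat) : R :=
  etamin + (etamax - etamin) * (1 - t%:R / T%:R) `^ p.

Definition min_expected_sqgrad (R : realType) (n : nat)
    (M : riemannian_manifold R n) (d : measure_display)
    (Omega : measurableType d) (P : probability Omega R) (f : M -> R)
    (x : nat -> Omega -> M) (T : nat) : \bar R :=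
  \big[Order.min/+oo%E]_(t < T)
    ('E_P[fun w => (tnorm (x t w) (grad f (x t w)) ^+ 2)%R])%E.

(* Samples are indexed from 0. The sample space is quantified after [bound],
   which thus depends neither on it nor on the samples. *)
Definition rsgd_bound (R : realType) (n : nat) (M : riemannian_manifold R n)
    (retr : M -> 'rV[R]_n -> M) (N : nat) (fs : 'I_N -> M -> R)
    (law : 'I_N -> R) (b : nat -> nat) (x0 : M) (eta : nat -> nat -> R)
    (bound : nat -> R) : Prop :=
  forall (T : nat), (0 < T)%N ->
  forall (d : measure_display) (Omega : measurableType d)
    (P : probability Omega R) (xi : nat -> nat -> Omega -> 'I_N),
  iid_with_law P law xi ->
  (min_expected_sqgrad P (average fs)
     (fun t w => rsgd retr fs (eta T) b (fun i s => xi i s w) x0 t) T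
   <= (bound T)%:E)%E.

(* Main.v *)
(* Given the past, the batch gradient h has mean grad f(x) and
   E|h|^2 <= |grad f(x)|^2 + sigma^2 / b_t, so retraction smoothness gives
     E f(x_(t+1)) <= E f(x_t) - eta_t (1 - L eta_t / 2) E|grad f(x_t)|^2
                     + (L / 2) eta_t^2 sigma^2 / b_t.
   Telescoping bounds the minimum by (C1 + C2 sum_t 1/b_t) / sum_t eta_t.
   The numerator is bounded because sum_t 1/b_t converges (geometrically, or
   like sum m^-c with c > 1), while sum_t eta_t is at least of order sqrt T for
   the diminishing rate and of order T for the others, whose values on the
   first half of the run are bounded below by a fixed multiple of etamax.
   The samples take finitely many values, so conditional expectations are
   finite averages and the measure space only enters when E|grad f(x_t)|^2 is
   identified with such an average. *)
Require Import Defs.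
From HB Require Import structures.
From mathcomp Require Import all_boot all_order all_algebra.
From mathcomp Require Import all_classical all_reals all_analysis.
From mathcomp Require Import ring lra zify.

Set Implicit Arguments.
Unset Strict Implicit.
Unset Printing Implicit Defensive.

Import Order.TTheory GRing.Theory Num.Theory.
Import numFieldNormedType.Exports.

Local Open Scope classical_set_scope.
Local Open Scope ring_scope.

(** * Finite averages over resampled coordinates *)

Section SampleAverage.
Context {R : realType} {I : eqType} {N : nat} (law : 'I_N -> R).
Hypothesis hlaw : is_pmf law.
Implicit Types (u v : I -> 'I_N) (F G : (I -> 'I_N) -> R) (s : seq I).

(* The conditional expectation of F when the coordinates listed by s are
   resampled independently with the given law. *)
Fixpoint sample_avg s F u : R :=
  if s is k :: s' then
    \sum_(j < N) law j * sample_avg s' (fun v => F [eta v with k |-> j]) u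
  else F u.

(** Stands in for measurability with respect to the samples listed by [s]. *)
Definition depends_on s F := forall u v, {in s, u =1 v} -> F u = F v.

Lemma depends_on_cons k s F j : depends_on (k :: s) F ->
  depends_on s (fun v => F [eta v with k |-> j]).
Proof.
move=> Fs u v uv; apply: Fs => l; rewrite inE /=.
by case: eqP => //= _ /uv.
Qed.

(** Resampling alters only the coordinates in [s], so the comparison may assume agreement with [u]
    elsewhere. This is how the past is held fixed while a batch is averaged. *)
Lemma le_sample_avg s F G u :
  (forall v, (forall l, l \notin s -> v l = u l) -> F v <= G v) ->
  sample_avg s F u <= sample_avg s G u.
Proof.
elim: s F G => [|k s IHs] F G FG /=; first exact: FG.
apply: ler_sum => j _; apply: ler_wpM2l; first exact: (proj1 hlaw).
apply: IHs => v vu; apply: FG => l; rewrite inE negb_or => /andP[/negPf lk ls].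
by rewrite /= lk vu.
Qed.

Lemma sample_avg_cst s a u : sample_avg s (fun=> a) u = a.
Proof.
elim: s => //= k s ->.
by rewrite -mulr_suml (proj2 hlaw) mul1r.
Qed.

Lemma sample_avg_sum (J : finType) s (F : J -> (I -> 'I_N) -> R) (a : J -> R) u :
  sample_avg s (fun v => \sum_j a j * F j v) u =
  \sum_j a j * sample_avg s (F j) u.
Proof.
elim: s F => //= k s IHs F.
under eq_bigr do rewrite IHs mulr_sumr.
rewrite exchange_big /=; apply: eq_bigr => j _.
by rewrite mulr_sumr; apply: eq_bigr => i _; rewrite mulrCA.
Qed.

Lemma sample_avg_lin s F G (a c : R) u :
  sample_avg s (fun v => F v + a * G v + c) u =
  sample_avg s F u + a * sample_avg s G u + c.
Proof.
elim: s F G => //= k s IHs F G.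
under eq_bigr do rewrite IHs !mulrDr.
rewrite !big_split /= -mulr_suml (proj2 hlaw) mul1r mulr_sumr.
by congr (_ + _ + _); apply: eq_bigr => j _; rewrite mulrCA.
Qed.

(** Tower property: [s] is averaged first, with the coordinates outside it frozen. *)
Lemma sample_avg_cat s s' F u :
  sample_avg (s ++ s') F u = sample_avg s' (sample_avg s F) u.
Proof.
elim: s F => //= k s IHs F.
by rewrite sample_avg_sum; apply: eq_bigr => j _; rewrite IHs.
Qed.

(** A random walk with independent increments [Y], each raising the mean of [q] by at most [delta].
    The induction is over all starting points, so that the first increment can be absorbed into
    [x]. *)
Lemma sample_avg_walk (V : zmodType) (Y : 'I_N -> V) (q : V -> R) (delta : R) :
  (forall y, \sum_(j < N) law j * q (y + Y j) <= q y + delta) ->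
  forall s x u, uniq s ->
  sample_avg s (fun v => q (x + \sum_(k <- s) Y (v k))) u
    <= q x + (size s)%:R * delta.
Proof.
move=> qY; elim=> [|k s IHs] x u /=; first by rewrite big_nil addr0 mul0r addr0.
move=> /andP[ks us]; apply: (@le_trans _ _
  (\sum_(j < N) law j * (q (x + Y j) + (size s)%:R * delta))).
  apply: ler_sum => j _; apply: ler_wpM2l; first exact: (proj1 hlaw).
  apply: le_trans (IHs _ u us); apply: le_sample_avg => v _.
  rewrite big_cons /= eqxx addrA le_eqVlt; apply/orP; left; apply/eqP.
  (* As [k] is not in [s], fixing its value leaves the later increments unchanged. *)
  congr (q (_ + _)); rewrite !big_seq; apply: eq_bigr => l ls.
  by rewrite ifN //; apply: contra ks => /eqP <-.
under eq_bigr do rewrite mulrDr.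
rewrite big_split /= -mulr_suml (proj2 hlaw) mul1r -addn1 natrD mulrDl mul1r.
by rewrite (addrC (_ * delta)) addrA lerD2r.
Qed.

End SampleAverage.

(** * Expectations of functions of finitely many i.i.d. samples *)

Section IidExpectation.
Context {R : realType} {d : measure_display} {Omega : measurableType d}.
Context {P : probability Omega R} {N : nat} {law : 'I_N -> R}.
Context {xi : nat -> nat -> Omega -> 'I_N} (hxi : iid_with_law P law xi).
Implicit Types (r s : seq (nat * nat)) (a u : nat * nat -> 'I_N).
Implicit Types F : (nat * nat -> 'I_N) -> R.

Let sample (w : Omega) : nat * nat -> 'I_N := fun k => xi k.1 k.2 w.

Let cylinder r a : set Omega :=
  \bigcap_(k in [set` r]) (xi k.1 k.2 @^-1` [set a k]).

Let measurable_cylinder r a : measurable (cylinder r a).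
Proof.
case: hxi => mxi _ _; rewrite /cylinder bigcap_seq.
by apply: bigsetI_measurable => k _; exact: mxi.
Qed.

Let cylinder_cons k r a j : k \notin r ->
  cylinder (k :: r) [eta a with k |-> j] =
  (xi k.1 k.2 @^-1` [set j]) `&` cylinder r a.
Proof.
move=> kr; apply/seteqP; split=> w /=.
  move=> H; split; first by have := H k; rewrite /= mem_head eqxx; apply.
  move=> l lr; have := H l; rewrite /= inE lr orbT ifN; first exact.
  by apply: contra kr => /eqP <-.
move=> [wk H] l /=; rewrite inE => /orP[/eqP->|lr]; first by rewrite eqxx.
by rewrite ifN; [exact: H | apply: contra kr => /eqP <-].
Qed.

(** The product rules for [k :: r] and for [r] differ by the factor of [k]. This is the only place
    where independence enters. *)
Let probability_cylinder_cons k r a j : uniq (k :: r) ->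
  P (cylinder (k :: r) [eta a with k |-> j]) = ((law j)%:E * P (cylinder r a))%E.
Proof.
case: hxi => _ lawxi indxi /= /andP[kr ur].
rewrite /cylinder.
rewrite (indxi (k :: r) (fun l => [set [eta a with k |-> j] l])) /= ?kr//.
rewrite (indxi r (fun l => [set a l])) // big_cons eqxx lawxi; congr (_ * _)%E.
rewrite !big_seq; apply: eq_bigr => l lr.
by rewrite ifN//; apply: contra kr => /eqP <-.
Qed.

Lemma measurable_sample_fun s F : depends_on s F ->
  measurable_fun setT (fun w => F (sample w)).
Proof.
case: hxi => mxi _ _; elim: s F => [|k s IHs] F Fs.
  (* With no coordinate left [F] is constant; its value is read off at the default outcome, as
     ['I_N] has no canonical element. *)
  apply: (eq_measurable_fun (cst (F (fun k => xi k.1 k.2 point)))).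
    by move=> w _; exact: Fs.
  exact: measurable_cst.
move=> _ B mB; rewrite setTI.
have -> : (fun w => F (sample w)) @^-1` B = \bigcup_(j : 'I_N)
    ((xi k.1 k.2 @^-1` [set j]) `&`
     (fun w => F [eta sample w with k |-> j]) @^-1` B).
  have E w : F (sample w) = F [eta sample w with k |-> xi k.1 k.2 w].
    by congr F; apply/funext => l /=; case: eqP => // ->.
  apply/seteqP; split=> w /=; first by exists (xi k.1 k.2 w); rewrite //= -E.
  by move=> [j _ /= [<-]]; rewrite -E.
apply: fin_bigcup_measurable => // j _; apply: measurableI; first exact: mxi.
rewrite -[X in measurable X]setTI.
by apply: (IHs _ (depends_on_cons j Fs)) => //.
Qed.

(* Induction on s, splitting the cylinder by the value of one more sample. *)
Let integral_cylinder s r a F u : uniq (s ++ r) -> depends_on s F ->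
  (forall v, 0 <= F v) ->
  (\int[P]_(w in cylinder r a) (F (sample w))%:E =
   P (cylinder r a) * (sample_avg law s F u)%:E)%E.
Proof.
elim: s r a F => [|k s IHs] r a F /=.
  move=> _ Fs F0; rewrite (eq_integral (cst (F u)%:E)); last first.
    by move=> w _ /=; congr EFin; apply: Fs.
  by rewrite integral_cst// muleC.
rewrite mem_cat negb_or -andbA => /and3P[ks kr usr] Fs F0.
have cylE : cylinder r a = \big[setU/set0]_(j < N)
    cylinder (k :: r) [eta a with k |-> j].
  rewrite -bigcup_seq; apply/seteqP; split=> [w wr|w [j _]].
    exists (xi k.1 k.2 w); first by rewrite /= mem_index_enum.
    by rewrite cylinder_cons.
  by rewrite cylinder_cons// => -[].
rewrite {1}cylE ge0_integral_bigsetU//=.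
- rewrite -[P _]fineK ?fin_num_measure// -EFinM mulr_sumr -sumEFin.
  apply: eq_bigr => j _.
  (* On this piece sample [k] equals [j]; writing [j] into [F] leaves a function of [s] alone, as
     the induction hypothesis requires. *)
  transitivity (\int[P]_(w in cylinder (k :: r) [eta a with k |-> j])
      (F [eta sample w with k |-> j])%:E)%E.
    apply: eq_integral => w; rewrite inE cylinder_cons// => -[/= wk _].
    by congr EFin; apply: Fs => l _ /=; case: eqP => // ->.
  rewrite (IHs (k :: r) _ (fun v => F [eta v with k |-> j])) //.
  + rewrite probability_cylinder_cons /=; last first.
      by move: usr; rewrite cat_uniq kr => /and3P[].
    by rewrite -[P _]fineK ?fin_num_measure// -!EFinM; congr EFin; ring.
  + by rewrite -cat1s uniq_catCA /= mem_cat negb_or ks kr usr.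
  + exact: (depends_on_cons j Fs).
- exact: index_enum_uniq.
- by move=> i j _ _ [w []]; rewrite !cylinder_cons// => -[/= <- _] [/= <- _].
- apply/measurable_realfun.measurable_EFinP; apply: (measurable_funS measurableT) => //.
  exact: (@measurable_sample_fun (k :: s)).
- by move=> w _; rewrite lee_fin.
Qed.

(** The bridge from the measure space to finite averages: the empty cylinder is the whole space. All
    coordinates that [F] depends on are resampled, so the average is the same for every [u]. *)
Lemma expectation_sample s F u : uniq s -> depends_on s F -> (forall v, 0 <= F v) ->
  ('E_P[fun w => F (fun k => xi k.1 k.2 w)] = (sample_avg law s F u)%:E)%E.
Proof.
move=> us Fs F0; rewrite unlock.
have cyl0 : cylinder [::] u = setT by rewrite /cylinder set_nil bigcap_set0.
have := @integral_cylinder s [::] u F u; rewrite cats0 cyl0 probability_setT mul1e.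
exact.
Qed.

End IidExpectation.

(** * Expected decrease in a single step *)

Section Descent.
Context {R : realType} {n : nat} {M : riemannian_manifold R n}.
Implicit Types (x : M) (u v w : 'rV[R]_n).

Lemma innerDl x u v w : inner x (u + v) w = inner x u w + inner x v w.
Proof. by have := inner_linear x u v w 1; rewrite scale1r mul1r. Qed.

Lemma inner0l x w : inner x 0 w = 0.
Proof. by have := innerDl x 0 0 w; rewrite addr0; lra. Qed.

Lemma innerZl x k u w : inner x (k *: u) w = k * inner x u w.
Proof. by have := inner_linear x u 0 w k; rewrite addr0 inner0l addr0. Qed.

Lemma innerDr x u v w : inner x w (u + v) = inner x w u + inner x w v.
Proof. by rewrite !(inner_sym x w) innerDl. Qed.

Lemma innerZr x k u w : inner x w (k *: u) = k * inner x w u.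
Proof. by rewrite !(inner_sym x w) innerZl. Qed.

Lemma inner_sumr x w J (r : seq J) (F : J -> 'rV[R]_n) :
  inner x w (\sum_(j <- r) F j) = \sum_(j <- r) inner x w (F j).
Proof.
by apply: (big_morph (inner x w)) => [u v|]; [rewrite innerDr | rewrite inner_sym inner0l].
Qed.

Lemma sqr_tnorm x u : tnorm x u ^+ 2 = inner x u u.
Proof.
rewrite /tnorm sqr_sqrtr//; have [->|u0] := eqVneq u 0; first by rewrite inner0l.
by rewrite ltW// inner_pos.
Qed.

(** The batch mean is a walk from [g] with [m] centred steps [(G j - g) / m], where [m] is the batch
    size. Centring kills the linear terms, and each step adds at most [B * sigma ^+ 2 / m ^+ 2],
    hence the total [B * sigma ^+ 2 / m]. *)
Lemma sample_avg_quadratic (I : eqType) (N : nat) (law : 'I_N -> R) x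
    (G : 'I_N -> 'rV[R]_n) (g : 'rV[R]_n) (A B sigma : R) (s : seq I)
    (z : I -> 'I_N) :
  is_pmf law -> 0 <= B -> \sum_(j < N) law j *: G j = g ->
  \sum_(j < N) law j * tnorm x (G j - g) ^+ 2 <= sigma ^+ 2 ->
  uniq s -> (0 < size s)%N ->
  sample_avg law s (fun y =>
      let h := (size s)%:R^-1 *: \sum_(k <- s) G (y k) in
      A * inner x g h + B * inner x h h) z <=
  A * inner x g g + B * inner x g g + B * sigma ^+ 2 / (size s)%:R.
Proof.
move=> hlaw B0 mean_G var_G us s0.
set m := (size s)%:R : R; have m0 : 0 < m by rewrite ltr0n.
pose Y j := m^-1 *: (G j - g).
pose q y := A * inner x g y + B * inner x y y.
have Y0 : \sum_(j < N) law j *: Y j = 0.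
  transitivity (m^-1 *: \sum_(j < N) (law j *: G j - law j *: g)).
    rewrite scaler_sumr; apply: eq_bigr => j _.
    by rewrite /Y -scalerBr !scalerA mulrC.
  by rewrite sumrB mean_G -scaler_suml (proj2 hlaw) scale1r subrr scaler0.
have Ylin w : \sum_(j < N) law j * inner x w (Y j) = 0.
  under eq_bigr do rewrite -innerZr.
  by rewrite -inner_sumr Y0 inner_sym inner0l.
have Ysqr : \sum_(j < N) law j * inner x (Y j) (Y j) <= sigma ^+ 2 / m ^+ 2.
  rewrite (eq_bigr (fun j => (law j * tnorm x (G j - g) ^+ 2) * m^-1 ^+ 2)); last first.
    by move=> j _; rewrite sqr_tnorm /Y innerZl innerZr; ring.
  by rewrite -mulr_suml exprVn ler_wpM2r// invr_ge0 exprn_ge0// ltW.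
have qY y : \sum_(j < N) law j * q (y + Y j) <= q y + B * (sigma ^+ 2 / m ^+ 2).
  rewrite (eq_bigr (fun j => law j * q y + A * (law j * inner x g (Y j))
      + 2 * B * (law j * inner x y (Y j))
      + B * (law j * inner x (Y j) (Y j)))); last first.
    by move=> j _; rewrite /q !innerDr !innerDl (inner_sym x (Y j) y); ring.
  rewrite !big_split /= -mulr_suml -!mulr_sumr (proj2 hlaw) !Ylin !mulr0 !addr0 mul1r.
  by rewrite lerD2l ler_wpM2l.
have walk := sample_avg_walk hlaw qY g z us.
have -> : A * inner x g g + B * inner x g g + B * sigma ^+ 2 / m =
    q g + m * (B * (sigma ^+ 2 / m ^+ 2)).
  by rewrite /q; field; rewrite gt_eqF.
apply: le_trans walk; apply: le_sample_avg => // y _ /=.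
suff -> : m^-1 *: (\sum_(k <- s) G (y k)) = g + \sum_(k <- s) Y (y k) by [].
rewrite /Y -scaler_sumr sumrB big_const_seq count_predT iter_addr_0.
by rewrite -scaler_nat scalerBr scalerA mulVf ?gt_eqF// scale1r addrC subrK.
Qed.

(** Retraction smoothness along [- eta *: h] gives a quadratic in the batch gradient [h], with
    coefficients [A = - eta] and [B = L / 2 * eta ^+ 2]. *)
Lemma sample_avg_descent (I : eqType) (N : nat) (law : 'I_N -> R)
    (fs : 'I_N -> M -> R) (retr : M -> 'rV[R]_n -> M) (L sigma eta : R) x
    (s : seq I) (z : I -> 'I_N) :
  is_pmf law -> 0 < L -> bounded_variance_estimator fs law sigma ->
  retraction_smooth retr (average fs) L -> uniq s -> (0 < size s)%N ->
  sample_avg law s (fun y => average fs (retr x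
      (- (eta *: ((size s)%:R^-1 *: \sum_(k <- s) grad (fs (y k)) x))))) z <=
  average fs x - eta * (1 - L * eta / 2) * tnorm x (grad (average fs) x) ^+ 2
    + L / 2 * eta ^+ 2 * sigma ^+ 2 / (size s)%:R.
Proof.
move=> hlaw L0 [mean_grad var_grad] hRS us s0.
have B0 : 0 <= L / 2 * eta ^+ 2 by rewrite mulr_ge0 ?sqr_ge0// divr_ge0// ltW.
have := sample_avg_quadratic (- eta) z hlaw B0 (mean_grad x) (var_grad x) us s0.
move: (hRS x); rewrite sqr_tnorm; move: (grad (average fs) x) (average fs x) => g fx.
move=> hx; set Q := sample_avg _ _ _ _ => hQ.
apply: (@le_trans _ _ (fx + Q)); last by lra.
(* The right side is brought to the shape of [sample_avg_lin], so that the inequality can be checked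
   for each sample assignment. *)
rewrite -[fx in leRHS](sample_avg_cst hlaw s _ z) -[_ + Q]addr0.
rewrite -[Q]mul1r -(sample_avg_lin hlaw); apply: le_sample_avg => // y _ /=.
apply: le_trans (hx _) _; rewrite sqr_tnorm -scaleNr !(innerZl, innerZr).
by rewrite le_eqVlt; apply/orP; left; apply/eqP; ring.
Qed.

End Descent.

(** * Telescoping along the run *)

Section Telescoping.
Context {R : realType} {n : nat} {M : riemannian_manifold R n}.
Context (retr : M -> 'rV[R]_n -> M) {N : nat} (fs : 'I_N -> M -> R).
Context (law : 'I_N -> R) (b : nat -> nat) (x0 : M) (L sigma : R).
Hypotheses (hlaw : is_pmf law) (L0 : 0 < L).
Hypothesis hBV : bounded_variance_estimator fs law sigma.
Hypothesis hRS : retraction_smooth retr (average fs) L.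
Hypothesis b_gt0 : forall t, (0 < b t)%N.

Definition batch (t : nat) : seq (nat * nat) := [seq (i, t) | i <- iota 0 (b t)].

(** The newest batch comes first, so that [sample_avg_cat] averages it conditionally on the earlier
    ones. *)
Fixpoint past (t : nat) : seq (nat * nat) :=
  if t is s.+1 then batch s ++ past s else [::].

Lemma batch_uniq t : uniq (batch t).
Proof. by rewrite map_inj_uniq ?iota_uniq// => i j []. Qed.

Lemma mem_batch k t : k \in batch t -> k.2 = t.
Proof. by case/mapP => i _ ->. Qed.

Lemma mem_past k t : k \in past t -> (k.2 < t)%N.
Proof.
elim: t => //= t IHt; rewrite mem_cat => /orP[/mem_batch ->//|/IHt].
exact: ltnW.
Qed.

Lemma past_uniq t : uniq (past t).
Proof.
elim: t => //= t IHt; rewrite cat_uniq batch_uniq IHt andbT.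
by apply/hasPn => k /mem_past kt; apply/negP => /mem_batch kE; rewrite kE ltnn in kt.
Qed.

Lemma batch_gradE t (v : nat * nat -> 'I_N) (x : M) :
  batch_grad fs (b t) (fun i => v (i, t)) x =
  (size (batch t))%:R^-1 *: \sum_(k <- batch t) grad (fs (v k)) x.
Proof.
rewrite /batch_grad size_map size_iota /batch big_map; congr (_ *: _).
by rewrite -(big_mkord xpredT (fun i => grad (fs (v (i, t))) x)) /index_iota subn0.
Qed.

Section Run.
Variable eta : nat -> R.

Let x (t : nat) (v : nat * nat -> 'I_N) : M :=
  rsgd retr fs eta b (fun i s => v (i, s)) x0 t.

Lemma rsgd_step t v : x t.+1 v = retr (x t v) (- (eta t *:
  ((size (batch t))%:R^-1 *: \sum_(k <- batch t) grad (fs (v k)) (x t v)))).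
Proof. by rewrite -batch_gradE. Qed.

(** Adaptedness of the iterates: it keeps [x t] fixed while batch [t] is resampled. *)
Lemma eq_rsgd_past t u v : {in past t, u =1 v} -> x t u = x t v.
Proof.
elim: t => [//|t IHt] uv; rewrite !rsgd_step.
have -> : x t u = x t v by apply: IHt => k kt; apply: uv; rewrite mem_cat kt orbT.
congr (retr _ (- (_ *: (_ *: _)))); rewrite big_seq [RHS]big_seq.
by apply: eq_bigr => k kt; rewrite uv// mem_cat kt.
Qed.

Lemma rsgd_descent (u : nat * nat -> 'I_N) (T : nat) (fmin : R) :
  (forall y, fmin <= average fs y) ->
  \sum_(t < T) eta t * (1 - L * eta t / 2) *
      sample_avg law (past t) (fun v => tnorm (x t v) (grad (average fs) (x t v)) ^+ 2) u
    <= average fs x0 - fmin + L / 2 * sigma ^+ 2 * \sum_(t < T) eta t ^+ 2 / (b t)%:R.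
Proof.
move=> hfmin; pose phi t := sample_avg law (past t) (fun v => average fs (x t v)) u.
(* The telescoped inequality is proved by induction on [T]; the lower bound [fmin] on [phi T] then
   gives the claim. *)
suff : phi T <= average fs x0
    - \sum_(t < T) eta t * (1 - L * eta t / 2) *
      sample_avg law (past t) (fun v => tnorm (x t v) (grad (average fs) (x t v)) ^+ 2) u
    + L / 2 * sigma ^+ 2 * \sum_(t < T) eta t ^+ 2 / (b t)%:R.
  have : fmin <= phi T.
    by rewrite -(sample_avg_cst hlaw (past T) fmin u); exact: le_sample_avg.
  lra.
elim: T => [|T IHT]; first by rewrite !big_ord0 /phi /x /=; lra.
rewrite !big_ord_recr /=; set e := sample_avg _ (past T) _ _.
suff : phi T.+1 <= phi T + - (eta T * (1 - L * eta T / 2)) * e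
     + L / 2 * eta T ^+ 2 * sigma ^+ 2 / (b T)%:R by move: IHT; lra.
(* Both sides become averages over [past T], so it suffices to compare them for each fixed past
   [v]. *)
rewrite /phi /= sample_avg_cat -sample_avg_lin//.
apply: le_sample_avg => // v _.
have batchE : size (batch T) = b T by rewrite size_map size_iota.
have batch0 : (0 < size (batch T))%N by rewrite batchE.
have := sample_avg_descent (eta T) (x T v) v hlaw L0 hBV hRS (batch_uniq T) batch0.
move=> descent; apply: (le_trans _ (le_trans descent _)); last by rewrite batchE mulNr.
apply: le_sample_avg => // w wv; rewrite rsgd_step (@eq_rsgd_past T w v)// => k kT; apply: wv.
by apply/negP => /mem_batch kE; have := mem_past kT; rewrite kE ltnn.
Qed.

End Run.

(** Common to all schedules: [g T] is the growth order of the sum of the rates. The condition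
    [etamax < 2 / L] makes [delta] positive, and [delta] bounds every [1 - L * eta T t / 2] from
    below. *)
Lemma rsgd_rate (eta : nat -> nat -> R) (etamax S fmin rho : R) (g : nat -> R) :
  0 < etamax -> etamax < 2 / L ->
  (forall y, fmin <= average fs y) ->
  (forall T, \sum_(t < T) (b t)%:R^-1 <= S) ->
  (forall T t, (t < T)%N -> 0 <= eta T t <= etamax) ->
  0 < rho -> (forall T, (0 < T)%N -> 0 < g T) ->
  (forall T, (0 < T)%N -> rho * g T <= \sum_(t < T) eta T t) ->
  let delta := 1 - L * etamax / 2 in
  rsgd_bound retr fs law b x0 eta (fun T =>
    ((average fs x0 - fmin) / (delta * rho)
     + L * etamax ^+ 2 * S / (2 * (delta * rho)) * sigma ^+ 2) / g T).
Proof.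
move=> etamax0 etamaxL hfmin hS eta_bnd rho0 g0 eta_sum delta T T0 d Omega P xi hxi.
have delta0 : 0 < delta by move: etamaxL; rewrite /delta ltr_pdivlMr//; lra.
pose x t v := rsgd retr fs (eta T) b (fun i s => v (i, s)) x0 t.
pose h t v := tnorm (x t v) (grad (average fs) (x t v)) ^+ 2.
pose u : nat * nat -> 'I_N := fun k => xi k.1 k.2 point.
pose e t := sample_avg law (past t) (h t) u.
have e0 t : 0 <= e t.
  by rewrite -(sample_avg_cst hlaw (past t) 0 u); apply: le_sample_avg => // v _; exact: sqr_ge0.
(* It is enough to bound [e j] at a minimizer [j]; minimality replaces every [e t] by [e j] in
   [signal]. *)
pose i0 := Ordinal T0; case: (@arg_minP _ _ _ i0 xpredT (fun t : 'I_T => e t)) => // j _ jmin.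
rewrite /min_expected_sqgrad; apply: (@bigmin_inf _ _ _ _ j) => //.
rewrite (@expectation_sample _ _ _ _ _ _ _ hxi (past j) (h j) u) ?lee_fin.
- have : \sum_(t < T) eta T t * (1 - L * eta T t / 2) * e t <= _ :=
    rsgd_descent (eta T) u T hfmin.
  rewrite -/(e j); move: e e0 jmin => e e0 jmin descent.
  have noise : \sum_(t < T) eta T t ^+ 2 / (b t)%:R <= etamax ^+ 2 * S.
    apply: (@le_trans _ _ (etamax ^+ 2 * \sum_(t < T) (b t)%:R^-1)); last first.
      by rewrite ler_wpM2l ?sqr_ge0.
    rewrite mulr_sumr; apply: ler_sum => t _; have /andP[? ?] := eta_bnd T t (ltn_ord t).
    by rewrite ler_wpM2r ?invr_ge0// lerXn2r// nnegrE (le_trans _ (ltW etamax0)).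
  have signal : delta * e j * (rho * g T) <=
      \sum_(t < T) eta T t * (1 - L * eta T t / 2) * e t.
    apply: (@le_trans _ _ (delta * e j * \sum_(t < T) eta T t)).
      by rewrite ler_wpM2l ?eta_sum// mulr_ge0// ltW.
    rewrite mulr_sumr; apply: ler_sum => t _; have /andP[? ?] := eta_bnd T t (ltn_ord t).
    rewrite (mulrC _ (eta T t)) -(mulrA (eta T t)) ler_wpM2l//.
    rewrite ler_pM ?jmin ?(ltW delta0)//.
    by rewrite /delta lerB// ler_wpM2r ?invr_ge0// ler_wpM2l// ltW.
  have drg0 : 0 < delta * (rho * g T) by rewrite !mulr_gt0// g0.
  have le_ej : e j * (delta * (rho * g T)) <=
      average fs x0 - fmin + L / 2 * sigma ^+ 2 * (etamax ^+ 2 * S).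
    rewrite mulrCA mulrA; apply: (le_trans (le_trans signal descent)).
    by rewrite lerD2l ler_wpM2l// mulr_ge0 ?sqr_ge0// divr_ge0// ltW.
  move: le_ej; rewrite -ler_pdivlMr// => /le_trans; apply.
  rewrite le_eqVlt; apply/orP; left; apply/eqP; field.
  by rewrite !gt_eqF ?g0.
- exact: past_uniq.
- by move=> v w vw; rewrite /h /x (eq_rsgd_past _ vw).
- by move=> v; exact: sqr_ge0.
Qed.

End Telescoping.

(** * Summability of the inverse batch sizes *)

Lemma sum_divn_block (R : realType) (h : nat -> R) (K n : nat) : (0 < K)%N ->
  \sum_(t < K * n) h (t %/ K)%N = K%:R * \sum_(m < n) h m.
Proof.
move=> K0; elim: n => [|n IHn]; first by rewrite muln0 !big_ord0 mulr0.
rewrite mulnS addnC big_split_ord /= IHn big_ord_recr /= mulrDr; congr (_ + _).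
rewrite (eq_bigr (fun=> h n)); first by rewrite sumr_const card_ord mulr_natl.
by move=> i _; rewrite mulnC divnMDl// divn_small// addn0.
Qed.

(** Extending the range from [T] to [K * T] adds nonnegative terms and leaves only complete
    blocks. *)
Lemma sum_divn_le (R : realType) (h : nat -> R) (K : nat) (S : R) : (0 < K)%N ->
  (forall m, 0 <= h m) -> (forall n, \sum_(m < n) h m <= S) ->
  forall T, \sum_(t < T) h (t %/ K)%N <= K%:R * S.
Proof.
move=> K0 h0 hS T; apply: (@le_trans _ _ (K%:R * \sum_(m < T) h m)); last first.
  by rewrite ler_wpM2l.
rewrite -sum_divn_block// -(subnKC (leq_pmull T K0)) big_split_ord /= lerDl.
exact: sumr_ge0.
Qed.

Lemma sum_geometric_le (R : realType) (r : R) (n : nat) : 0 <= r < 1 ->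
  \sum_(i < n) r ^+ i <= (1 - r)^-1.
Proof.
move=> /andP[r0 r1]; rewrite -[leRHS]mul1r ler_pdivlMr ?subr_gt0//.
have := subrX1 r n; have := exprn_ge0 n r0; lra.
Qed.

(* Cauchy condensation. *)
Lemma sum_dyadic_le (R : realType) (h : nat -> R) (k : nat) :
  {homo h : i j / (i <= j)%N >-> j <= i} ->
  \sum_(i < 2 ^ k) h i <= h 0 + \sum_(i < k) 2 ^+ i * h (2 ^ i)%N.
Proof.
move=> hh; elim: k => [|k IHk]; first by rewrite big_ord0 big_ord1 addr0.
rewrite expnS mul2n -addnn big_split_ord /= big_ord_recr /= addrA lerD//.
have -> : 2 ^+ k * h (2 ^ k)%N = \sum_(i < 2 ^ k) h (2 ^ k)%N.
  by rewrite sumr_const card_ord -[RHS]mulr_natl natrX.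
by apply: ler_sum => i _; apply: hh; exact: leq_addr.
Qed.

Lemma sum_powR_le (R : realType) (a b0 c : R) : 0 < a -> 0 < b0 -> 1 < c ->
  exists S, forall n, \sum_(m < n) ((a * m%:R + b0) `^ c)^-1 <= S.
Proof.
move=> a0 b00 c1; pose h m := ((a * m%:R + b0) `^ c)^-1 : R.
have hpos m : 0 < a * m%:R + b0 by rewrite ltr_wpDl// mulr_ge0// ltW.
have h0 m : 0 <= h m by rewrite invr_ge0 powR_ge0.
have c0 : 0 <= c by rewrite ltW// (lt_trans _ c1).
have hh : {homo h : i j / (i <= j)%N >-> j <= i}.
  move=> i j ij; rewrite /h lef_pV2 ?posrE ?powR_gt0//.
  apply: ge0_ler_powR; rewrite ?nnegrE ?(ltW (hpos _))//.
  by rewrite lerD2r ler_wpM2l ?(ltW a0)// ler_nat.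
pose r : R := 2 `^ (1 - c).
have r01 : 0 <= r < 1.
  by rewrite powR_ge0 /r /powR pnatr_eq0 /= expR_lt1 pmulr_llt0 ?subr_lt0// ln_gt0// ltr1n.
exists (h 0 + (a `^ c)^-1 * (1 - r)^-1) => n.
apply: (@le_trans _ _ (\sum_(i < 2 ^ n) h i)).
  rewrite -(subnKC (ltnW (ltn_expl n (isT : (1 < 2)%N)))) big_split_ord /= lerDl.
  exact: sumr_ge0.
apply: (le_trans (sum_dyadic_le n hh)); rewrite lerD2l.
apply: (@le_trans _ _ ((a `^ c)^-1 * \sum_(i < n) r ^+ i)); last first.
  by rewrite ler_wpM2l ?invr_ge0 ?powR_ge0// sum_geometric_le.
rewrite mulr_sumr; apply: ler_sum => i _.
have -> : (a `^ c)^-1 * r ^+ i = 2 ^+ i * ((a * (2 ^ i)%:R) `^ c)^-1.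
  rewrite powRM ?(ltW a0)// invfM mulrCA; congr (_ * _).
  rewrite /r -powR_mulrn ?powR_ge0// -powRrM mulrBl mul1r powRD ?pnatr_eq0 ?implybT//.
  rewrite powR_mulrn//; congr (_ * _).
  by rewrite -powRN natrX -powR_mulrn// -powRrM mulrN mulrC.
(* Dropping [b0] shrinks the base and so enlarges the inverse power. *)
rewrite ler_wpM2l ?exprn_ge0// lef_pV2 ?posrE ?powR_gt0 ?mulr_gt0 ?ltr0n ?expn_gt0//.
apply: ge0_ler_powR; rewrite ?nnegrE ?(ltW (hpos _)) ?mulr_ge0 ?(ltW a0)//.
by rewrite lerDl ltW.
Qed.

Lemma sum_inv_batch_le (R : realType) (b0 gamma c a : R) (K : nat) (b : nat -> nat) :
  0 < b0 -> 1 < gamma -> 1 < c -> 0 < a -> (0 < K)%N ->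
  exponential_batch K b0 gamma b \/ polynomial_batch K b0 a c b ->
  (forall t, (0 < b t)%N) /\ exists S : R, forall T, \sum_(t < T) (b t)%:R^-1 <= S.
Proof.
move=> b00 gamma1 c1 a0 K0 [] hb.
- have g0 : 0 < gamma by rewrite (lt_trans ltr01).
  split=> [t|]; first by rewrite -(ltr0n R) hb mulr_gt0// exprn_gt0.
  (* Each term of the geometric series of ratio [gamma^-1] is repeated at most [K] times. *)
  exists (K%:R * (b0^-1 * (1 - gamma^-1)^-1)) => T.
  under eq_bigr do rewrite hb.
  apply: (sum_divn_le (h := fun m => (b0 * gamma ^+ m)^-1)) => // [m|n].
    by rewrite invr_ge0 mulr_ge0 ?exprn_ge0 ?ltW.
  under eq_bigr do rewrite invfM -exprVn.
  rewrite -mulr_sumr ler_wpM2l ?invr_ge0 ?(ltW b00)//.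
  by apply: sum_geometric_le; rewrite invr_ge0 ltW//= invf_lt1.
- split=> [t|].
    by rewrite -(ltr0n R) hb powR_gt0// ltr_wpDl// mulr_ge0// ltW.
  have [S hS] := sum_powR_le a0 b00 c1.
  exists (K%:R * S) => T; under eq_bigr do rewrite hb.
  apply: (sum_divn_le (h := fun m => ((a * m%:R + b0) `^ c)^-1)) => // m.
  by rewrite invr_ge0 powR_ge0.
Qed.

(** * Growth of sums of rates, and the asymptotic notation *)

Lemma sum_sqrt_ge (R : realType) (T : nat) : (0 < T)%N ->
  Num.sqrt T%:R <= \sum_(t < T) (Num.sqrt t.+1%:R)^-1 :> R.
Proof.
move=> T0; apply: (@le_trans _ _ (\sum_(t < T) (Num.sqrt T%:R)^-1)); last first.
  apply: ler_sum => t _; rewrite lef_pV2 ?posrE ?sqrtr_gt0 ?ltr0n//.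
  by rewrite ler_wsqrtr// ler_nat.
rewrite sumr_const card_ord -[leRHS]mulr_natl ler_pdivlMr ?sqrtr_gt0 ?ltr0n//.
by rewrite -expr2 sqr_sqrtr.
Qed.

Lemma sum_half_ge (R : realType) (eta : nat -> R) (kappa : R) (T : nat) :
  0 <= kappa -> (forall t, (t < T)%N -> 0 <= eta t) ->
  (forall t, (t < T)%N -> (t.*2 <= T)%N -> kappa <= eta t) ->
  kappa / 2 * T%:R <= \sum_(t < T) eta t.
Proof.
(* Rounding up makes [m] at least [T / 2], while every [t < m] still satisfies [t.*2 <= T]. *)
move=> kappa0 eta0 eta_kappa; set m := uphalf T.
have mT : (m <= T)%N by rewrite /m; lia.
rewrite -(subnKC mT) big_split_ord /=; set A := \sum_(_ < m) _; set B := \sum_(_ < _) _.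
have B0 : 0 <= B by apply: sumr_ge0 => i _; apply: eta0; have := ltn_ord i; lia.
have Am : kappa * m%:R <= A.
  rewrite mulrC mulr_natl -[m in kappa *+ m]card_ord -sumr_const; apply: ler_sum => i _.
  by apply: eta_kappa; have := ltn_ord i; rewrite /m; lia.
rewrite subnKC//; apply: (@le_trans _ _ (kappa * m%:R)); last lra.
rewrite -mulrA ler_wpM2l// mulrC ler_pdivrMr// -natrM ler_nat /m; lia.
Qed.

Lemma bigO_div (R : realType) (C : R) (g : nat -> R) :
  ((fun T => C / g T) : nat -> R^o) =O_\oo ((fun T => (g T)^-1) : nat -> R^o).
Proof.
(* The added 1 keeps the constant positive when [C] is zero. *)
apply/eqO_exP; exists (`|C| + 1); first by rewrite ltr_wpDl.
by apply: nearW => T /=; rewrite normrM ler_wpM2r// lerDl.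
Qed.

(** * Bounds for the four learning rates *)

Section LearningRates.
Context {R : realType} (etamin etamax p : R).
Hypotheses (hmin : 0 <= etamin) (hminmax : etamin <= etamax).
Hypotheses (hmax0 : 0 < etamax) (hp : 0 < p).

Let ratio01 (T t : nat) : (t < T)%N -> 0 <= (t%:R / T%:R : R) <= 1.
Proof.
move=> tT; have T0 : 0 < T%:R :> R by rewrite ltr0n (leq_trans _ tT).
by rewrite divr_ge0//= ler_pdivrMr// mul1r ler_nat ltnW.
Qed.

Let ratio_half (T t : nat) : (t < T)%N -> (t.*2 <= T)%N -> t%:R / T%:R <= 2^-1 :> R.
Proof.
move=> tT t2T; have T0 : 0 < T%:R :> R by rewrite ltr0n (leq_trans _ tT).
rewrite ler_pdivrMr// mulrC ler_pdivlMr// -natrM ler_nat; lia.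
Qed.

Let one_powR : 1 `^ p = 1 :> R.
Proof. by rewrite powR1. Qed.

Lemma lr_diminishing_bnd T t : 0 <= lr_diminishing etamax T t <= etamax.
Proof.
rewrite /lr_diminishing divr_ge0 ?(ltW hmax0)//= ler_pdivrMr ?sqrtr_gt0 ?ltr0n//.
by rewrite ler_peMr ?(ltW hmax0)// -[leLHS]sqrtr1 ler_wsqrtr// ler1n.
Qed.

(** The rate is a convex combination of [etamin] and [etamax] with weights [(1 - x) / 2] and
    [(1 + x) / 2], where [x] is the cosine. *)
Lemma lr_cosine_bnd T t : 0 <= lr_cosine etamin etamax T t <= etamax.
Proof.
have [h0 h01] := (hmin, hminmax); rewrite /lr_cosine; set x := cos _.
have x1 : -1 <= x by exact: cos_geN1.
have x2 : x <= 1 by exact: cos_le1.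
clearbody x.
have h1 : 0 <= (etamax - etamin) * (1 + x) by apply: mulr_ge0; lra.
have h2 : 0 <= (etamax - etamin) * (1 - x) by apply: mulr_ge0; lra.
by apply/andP; split; lra.
Qed.

Lemma lr_polynomial_bnd T t : (t < T)%N -> 0 <= lr_polynomial etamin etamax p T t <= etamax.
Proof.
move=> /ratio01 /andP[r0 r1]; have [h0 h01] := (hmin, hminmax); rewrite /lr_polynomial; set x := _ `^ p.
have x0 : 0 <= x by exact: powR_ge0.
have x1 : x <= 1.
  rewrite -[leRHS]one_powR; apply: ge0_ler_powR; rewrite ?nnegrE ?(ltW hp)//; lra.
clearbody x.
have h1 : 0 <= (etamax - etamin) * x by apply: mulr_ge0; lra.
have h2 : 0 <= (etamax - etamin) * (1 - x) by apply: mulr_ge0; lra.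
by apply/andP; split; lra.
Qed.

Let halfp_bnd : 0 < (2^-1 : R) `^ p <= 1.
Proof.
rewrite powR_gt0//= -[leRHS]one_powR; apply: ge0_ler_powR; rewrite ?nnegrE ?(ltW hp)//; lra.
Qed.

(** The angle lies between 0 and [pi / 2], so the cosine is nonnegative and the rate is at least
    [(etamin + etamax) / 2]. *)
Lemma lr_cosine_half T t : (t < T)%N -> (t.*2 <= T)%N ->
  etamax / 2 <= lr_cosine etamin etamax T t.
Proof.
move=> tT t2T; have [h0 h01] := (hmin, hminmax); rewrite /lr_cosine; set x := cos _.
have x0 : 0 <= x.
  have pi0 := pi_ge0 R; have /andP[r0 _] := ratio01 tT.
  have h1 := mulr_ge0 r0 pi0.
  have h2 := ler_wpM2r pi0 (ratio_half tT t2T).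
  by apply: cos_ge0_pihalf; apply/andP; split; lra.
clearbody x.
have : 0 <= (etamax - etamin) * x by apply: mulr_ge0; lra.
lra.
Qed.

Lemma lr_polynomial_half T t : (t < T)%N -> (t.*2 <= T)%N ->
  etamax * 2^-1 `^ p <= lr_polynomial etamin etamax p T t.
Proof.
move=> tT t2T; have [h0 h01] := (hmin, hminmax); rewrite /lr_polynomial; set x := (1 - _) `^ p.
have : 2^-1 `^ p <= x.
  have r1 := ratio_half tT t2T.
  by apply: ge0_ler_powR; rewrite ?nnegrE ?(ltW hp)//; lra.
clearbody x => hx; have /andP[hp0 hp1] := halfp_bnd.
have : (etamax - etamin) * 2^-1 `^ p <= (etamax - etamin) * x by apply: ler_wpM2l; lra.
(* With [y] the power of one half, [etamin + (etamax - etamin) * y >= etamax * y] because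
   [y <= 1]. *)
have : etamin * 2^-1 `^ p <= etamin by apply: ler_piMr.
lra.
Qed.

(* On the first half of the run 1 - t / T >= 1/2, so that each rate is at least
   etamax * (1/2 * (1/2)^p). *)
Definition lr_mean : R := etamax * (2^-1 * 2^-1 `^ p) / 2.

Lemma lr_mean_gt0 : 0 < lr_mean.
Proof. by have /andP[h0 _] := halfp_bnd; rewrite !(mulr_gt0, divr_gt0). Qed.

Lemma sum_lr_diminishing_ge T : (0 < T)%N ->
  etamax * Num.sqrt T%:R <= \sum_(t < T) lr_diminishing etamax T t.
Proof.
move=> T0; rewrite /lr_diminishing -mulr_sumr ler_wpM2l ?(ltW hmax0)//.
exact: sum_sqrt_ge.
Qed.

(** One constant serves three rates: its factor [2^-1] suits the cosine and its power the polynomial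
    decay. The last division by 2 in [lr_mean] accounts for using only half of the run. *)
Let sum_lr_ge (eta : nat -> nat -> R) T :
  (forall t, (t < T)%N -> 0 <= eta T t <= etamax) ->
  (forall t, (t < T)%N -> (t.*2 <= T)%N -> etamax * (2^-1 * 2^-1 `^ p) <= eta T t) ->
  lr_mean * T%:R <= \sum_(t < T) eta T t.
Proof.
move=> eta_bnd eta_half; apply: sum_half_ge => //; last by move=> t /eta_bnd /andP[].
by have := lr_mean_gt0; rewrite /lr_mean; lra.
Qed.

Lemma sum_lr_constant_ge T : lr_mean * T%:R <= \sum_(t < T) lr_constant etamax T t.
Proof.
apply: (sum_lr_ge (eta := lr_constant etamax)) => t _; rewrite /lr_constant ?lexx ?(ltW hmax0)//.
move=> _; have /andP[_ h1] := halfp_bnd.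
by rewrite ler_piMr ?(ltW hmax0)//; lra.
Qed.

Lemma sum_lr_cosine_ge T : lr_mean * T%:R <= \sum_(t < T) lr_cosine etamin etamax T t.
Proof.
apply: sum_lr_ge => t tT; first exact: lr_cosine_bnd.
move=> t2T; apply: le_trans (lr_cosine_half tT t2T).
by rewrite ler_wpM2l ?(ltW hmax0)// ler_piMr//; have /andP[] := halfp_bnd.
Qed.

Lemma sum_lr_polynomial_ge T :
  lr_mean * T%:R <= \sum_(t < T) lr_polynomial etamin etamax p T t.
Proof.
apply: sum_lr_ge => t tT; first exact: lr_polynomial_bnd.
move=> t2T; apply: le_trans (lr_polynomial_half tT t2T).
rewrite ler_wpM2l ?(ltW hmax0)// ler_piMl ?powR_ge0//; lra.
Qed.

End LearningRates.

Theorem theorem6 (R : realType) (n : nat) (M : riemannian_manifold R n)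
    (retr : M -> 'rV[R]_n -> M) (N : nat) (fs : 'I_N -> M -> R)
    (law : 'I_N -> R) (Lr sigma etamin etamax p b0 gamma c a : R) (K : nat)
    (b : nat -> nat) (x0 : M)
    (hretr : retraction retr)
    (hsmooth : forall j, smooth_fun (fs j))
    (hbelow : forall j, bounded_below (fs j))
    (hLr : 0 < Lr)
    (hRS : retraction_smooth retr (average fs) Lr)
    (hlaw : is_pmf law)
    (hsigma : 0 < sigma)
    (hBV : bounded_variance_estimator fs law sigma)
    (hmin : 0 <= etamin) (hminmax : etamin <= etamax)
    (hmax : etamax < 2 / Lr) (hmax0 : 0 < etamax)
    (hp : 0 < p) (hK : (0 < K)%N) (hb0 : 0 < b0) (hgamma : 1 < gamma)
    (hc : 1 < c) (ha : 0 < a)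
    (hb : exponential_batch K b0 gamma b \/ polynomial_batch K b0 a c b) :
  exists Q1 Q2 Qt1 Qt2 : R,
    (let bound := fun T : nat =>
       (Q1 + Q2 * sigma ^+ 2 * b0^-1) / Num.sqrt T%:R in
     rsgd_bound retr fs law b x0 (lr_diminishing etamax) bound /\
     (bound : nat -> R^o) =O_\oo (fun T => (Num.sqrt T%:R)^-1 : R^o)) /\
    (let bound := fun T : nat =>
       (Qt1 + Qt2 * sigma ^+ 2 * b0^-1) / T%:R in
     [/\ rsgd_bound retr fs law b x0 (lr_constant etamax) bound,
         rsgd_bound retr fs law b x0 (lr_cosine etamin etamax) bound,
         rsgd_bound retr fs law b x0 (lr_polynomial etamin etamax p) bound &
         (bound : nat -> R^o) =O_\oo (fun T => T%:R^-1 : R^o)]).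
Proof.
have [b_gt0 [S hS]] := sum_inv_batch_le hb0 hgamma hc ha hK hb.
have [m hm] := choice hbelow.
(* The average of lower bounds of the [fs j] bounds their average from below. *)
pose fmin := N%:R^-1 * \sum_(j < N) m j.
have hfmin y : fmin <= average fs y.
  by rewrite ler_wpM2l ?invr_ge0//; apply: ler_sum => j _; exact: hm.
pose delta := 1 - Lr * etamax / 2.
(* Here [rho] is the factor in the lower bound on the sum of the rates: [etamax] against the square
   root of [T], or [lr_mean] against [T]. *)
pose Q rho := (average fs x0 - fmin) / (delta * rho).
pose Q' rho := Lr * etamax ^+ 2 * S / (2 * (delta * rho)).
have rho0 := lr_mean_gt0 hmax0 hp.
(* The bound S on the sum of the 1 / b_t already contains the dependence on b0. *)
exists (Q etamax), (Q' etamax * b0), (Q (lr_mean etamax p)), (Q' (lr_mean etamax p) * b0).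
have b0K rho : Q' rho * b0 * sigma ^+ 2 * b0^-1 = Q' rho * sigma ^+ 2.
  by rewrite mulrAC mulfK ?gt_eqF.
have rate := rsgd_rate x0 hlaw hLr hBV hRS b_gt0 hmax0 hmax hfmin hS.
rewrite !b0K; split; split => /=.
- apply: rate => //.
  + by move=> T t _; exact: lr_diminishing_bnd.
  + by move=> T T0; rewrite sqrtr_gt0 ltr0n.
  + by move=> T T0; exact: sum_lr_diminishing_ge.
- exact: bigO_div.
- apply: rate => //.
  + by move=> T t _; rewrite /lr_constant lexx ltW.
  + by move=> T; rewrite ltr0n.
  + by move=> T _; exact: sum_lr_constant_ge.
- apply: rate => //.
  + by move=> T t _; exact: lr_cosine_bnd.
  + by move=> T; rewrite ltr0n.
  + by move=> T _; exact: sum_lr_cosine_ge.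
- apply: rate => //.
  + by move=> T t; exact: lr_polynomial_bnd.
  + by move=> T; rewrite ltr0n.
  + by move=> T _; exact: sum_lr_polynomial_ge.
- exact: bigO_div.
Qed.
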